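(* Let $0<b<a$, where $b$ is not an integer, and let $T\in L(H)$. If $T$ is an $a$-contraction and $T\in\mathrm{Adm}^{w}_{(1-t)^b}$, then $T$ is a $b$-contraction.
   Context: $H$ is a separable Hilbert space and $L(H)$ is the algebra of bounded linear operators on $H$. For a power series $\alpha(t)=\sum_{n\ge0}\alpha_nt^n$, $\alpha(T^*,T):=\sum_{n=0}^\infty\alpha_nT^{*n}T^n$ whenever this series converges in the strong operator topology (SOT). For $c>0$, $T$ is a $c$-contraction if, for $\alpha(t)=(1-t)^c$, this series converges in SOT and $\alpha(T^*,T)\ge0$. For $\alpha$ with $\sum_n|\alpha_n|<\infty$, $T\in\mathrm{Adm}^w_{\alpha}$ means that $\sigma(T)\subset\overline{\mathbb{D}}$ (the closed unit disc) and the series $\sum_n|\alpha_n|T^{*n}T^n$ converges in SOT. *)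

(* Defs.v *)
From HB Require Import structures.
From mathcomp Require Import all_boot all_order all_algebra sesquilinear.
From mathcomp Require Import complex.
From mathcomp Require Import all_classical all_reals all_analysis.

Set Implicit Arguments.
Unset Strict Implicit.
Unset Printing Implicit Defensive.

Import Order.TTheory GRing.Theory Num.Theory Num.Def.
Import numFieldNormedType.Exports.

Local Open Scope classical_set_scope.
Local Open Scope complex_scope.
Local Open Scope ring_scope.

(* Complex Hilbert spaces; the inner product is linear in its first argument
   and conjugate-linear in the second. *)
HB.mixin Record isHilbert (R : realType) H
    & CompleteNormedModule R[i] H := {
  inner : {dot H for (@conjC R[i])} ;
  inner_norm : forall x : H, inner x x = `|x| ^+ 2
}.

#[short(type="hilbertType")]
HB.structure Definition Hilbert (R : realType) :=
  {H of CompleteNormedModule R[i] H & isHilbert R H}.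

Arguments inner {R s} : rename.

Definition separable (X : topologicalType) : Prop :=
  exists2 D : set X, countable D & dense D.

(* L(H) *)
Record bounded_op (R : realType) (H : hilbertType R) := BoundedOp {
  bounded_op_fun :> {linear H -> H} ;
  bounded_opP : exists M : R, forall x : H, `|bounded_op_fun x| <= M%:C * `|x|
}.

HB.instance Definition _ (R : realType) (H : hilbertType R) :=
  gen_eqMixin (bounded_op H).
HB.instance Definition _ (R : realType) (H : hilbertType R) :=
  gen_choiceMixin (bounded_op H).

(* The S in L(H) with <T x, y> = <x, S y>. It exists by the Riesz
   representation theorem and is unique, so the default value of xget is
   never used. *)
Definition adjoint (R : realType) (H : hilbertType R) (T : bounded_op H) :
    bounded_op H :=
  xget T [set S : bounded_op H |
           forall x y : H, inner (T x) y = inner x (S y)].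

(* A >= 0; in the order of R[i], 0 <= z says that z is real and nonnegative. *)
Definition positive_op (R : realType) (H : hilbertType R) (A : bounded_op H) :
    Prop :=
  forall x : H, 0 <= inner (A x) x.

Definition invertible_op (R : realType) (H : hilbertType R) (f : H -> H) :
    Prop :=
  exists S : bounded_op H, cancel S f /\ cancel f S.

Definition spectrum (R : realType) (H : hilbertType R) (T : bounded_op H) :
    set R[i] :=
  [set z : R[i] | ~ invertible_op (fun x : H => z *: x - T x)].

(* \sum_n alpha_n T^{*n} T^n converges in SOT and its sum is S. *)
Definition sot_sum (R : realType) (H : hilbertType R) (alpha : nat -> R)
    (T S : bounded_op H) : Prop :=
  forall x : H,
    series (fun n => (alpha n)%:C *: iter n (adjoint T) (iter n T x)) @ \oo
      --> S x.

(* Coefficients of (1 - t)^c = \sum_n (-1)^n binom(c, n) t^n. *)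
Definition coef_1mtX (R : realType) (c : R) (n : nat) : R :=
  (-1) ^+ n * ((\prod_(j < n) (c - j%:R)) / n`!%:R).

Definition c_contraction (R : realType) (H : hilbertType R) (c : R)
    (T : bounded_op H) : Prop :=
  exists S : bounded_op H, sot_sum (coef_1mtX c) T S /\ positive_op S.

(* Meant for alpha with \sum_n |alpha_n| < oo, which holds for
   coef_1mtX c whenever c > 0. *)
Definition Admw (R : realType) (H : hilbertType R) (alpha : nat -> R)
    (T : bounded_op H) : Prop :=
  spectrum T `<=` [set z : R[i] | `|z| <= 1] /\
  exists S : bounded_op H, sot_sum (fun n => `|alpha n|) T S.

(* Main.v *)
(* Put u_n = |T^n x|^2 and let al, be be the coefficients of (1-t)^a, (1-t)^b.
   Since b is not an integer, be has eventually constant sign, so admissibility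
   gives the strong convergence of the b-series and the absolute convergence of
   sum be_n u_n; the point is that this sum is nonnegative.  Formally it is
   sum_k ga_k v_k, with ga_k >= 0 the coefficients of (1-t)^(b-a) and
   v_k = sum_n al_n u_(n+k) >= 0, but this rearrangement is not absolutely
   convergent.  Instead ga is multiplied by cutoffs w^N with finite support,
   chosen so that (w^N ga) * al = be_m g(N-m) / g(N) for an explicit sequence g
   on the integers.  Averaging over N < L with weights g(N) produces the factor
   rho_L(m) = sum_(N<L) g(N-m) / sum_(N<L) g(N), which is bounded uniformly in L
   and m, and tends to 1 as L grows when a - b <= 1, because |g(x)| is then
   of size |x|^(b-a), which is not summable.  Dominated convergence settles the
   case a - b <= 1, and the general case follows by descending through
   ..., b + 2, b + 1, b. *)

From HB Require Import structures.
Require Import Defs.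
From mathcomp Require Import all_boot all_order all_algebra sesquilinear.
From mathcomp Require Import complex.
From mathcomp Require Import all_classical all_reals all_analysis.
From mathcomp Require Import ring lra.

Import Order.TTheory GRing.Theory Num.Theory Num.Def.
Import numFieldNormedType.Exports.

Local Open Scope classical_set_scope.
Local Open Scope complex_scope.
Local Open Scope ring_scope.

Set Implicit Arguments.
Unset Strict Implicit.
Unset Printing Implicit Defensive.

(** * Binomial coefficients and the cutoff convolution *)

(** In this form no denominator of [cutoff_coef] or [gshift] at a natural N vanishes. *)
Definition nonint (R : realType) (b : R) := forall N j : nat, N%:R + b - j%:R != 0.

Lemma coef_1mtX0 (R : realType) (c : R) : coef_1mtX c 0 = 1.
Proof. by rewrite /coef_1mtX big_ord0 expr0 fact0 divr1 mul1r. Qed.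

Lemma coef_1mtXS (R : realType) (c : R) n :
  coef_1mtX c n.+1 = coef_1mtX c n * ((n%:R - c) / n.+1%:R).
Proof.
rewrite /coef_1mtX big_ord_recr /= factS natrM exprS.
have nz : n`!%:R != 0 :> R by rewrite pnatr_eq0 -lt0n fact_gt0.
have nz1 : n.+1%:R != 0 :> R by rewrite pnatr_eq0.
by field; rewrite ?nat1r ?natr1 nz nz1.
Qed.

(* The coefficients of (1 - t)^(b - a), truncated after degree N when N is a
   natural number. The cutoff factor N^_k / (N + b)^_k is the one for which the
   convolution with (1 - t)^a has a closed form. *)
Definition cutoff_coef (R : realType) (a b N : R) (k : nat) : R :=
  coef_1mtX (b - a) k * \prod_(j < k) ((N - j%:R) / (N + b - j%:R)).

Lemma cutoff_coefS (R : realType) (a b N : R) k :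
  N + b - k%:R != 0 ->
  cutoff_coef a b N k.+1 * (k.+1%:R * (N + b - k%:R)) =
  cutoff_coef a b N k * ((k%:R + (a - b)) * (N - k%:R)).
Proof.
move=> nz; have nz1 : k.+1%:R != 0 :> R by rewrite pnatr_eq0.
rewrite /cutoff_coef coef_1mtXS big_ord_recr /=.
set P := \prod_(i < k) _; set C := coef_1mtX _ _.
by field; rewrite ?nat1r ?natr1 nz nz1.
Qed.

(* An instance of the Pfaff-Saalschutz sum. *)
Lemma cutoff_conv (R : realType) (a b N : R) m :
  (forall j : nat, N + b - j%:R != 0) ->
  \sum_(k < m.+1) cutoff_coef a b N k * coef_1mtX a (m - k) =
  coef_1mtX b m * \prod_(j < m) ((N + a - j%:R) / (N + b - j%:R)).
Proof.
move=> nz; set w := cutoff_coef a b N; set al := coef_1mtX a.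
elim: m => [|m IH].
  by rewrite big_ord1 /w /cutoff_coef /al !coef_1mtX0 !big_ord0 !mulr1.
have nz1 : m.+1%:R != 0 :> R by rewrite pnatr_eq0.
(* G is Zeilberger's certificate for the first-order recurrence in m. *)
pose G k := - (k%:R * (N - k%:R + 1 + b) * w k * al (m.+1 - k)%N).
have step (k : 'I_m.+1) : m.+1%:R * (N - m%:R + b) * (w k * al (m.+1 - k)%N) -
    (m%:R - b) * (N - m%:R + a) * (w k * al (m - k)%N) = G k.+1 - G k.
  have km : (k <= m)%N by rewrite -ltnS.
  have e1 : w k.+1 * (k.+1%:R * (N + b - k%:R)) =
      w k * ((k%:R + (a - b)) * (N - k%:R)) by exact: cutoff_coefS.
  have GS : G k.+1 = - (w k * ((k%:R + (a - b)) * (N - k%:R)) * al (m - k)%N).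
    by rewrite /G -e1 subSS -natr1; ring.
  have d0 : (m - k).+1%:R != 0 :> R by rewrite pnatr_eq0.
  have dE : (m - k).+1%:R = m%:R - k%:R + 1 :> R by rewrite -natr1 natrB.
  rewrite GS /G subSn // /al coef_1mtXS -/al dE natrB //.
  rewrite dE in d0.
  rewrite -(@natr1 R m); field.
  exact: d0.
(* G 0 = 0, while G m.+1 is minus the term k = m+1 times the factor of the recurrence; this is the
   term that the sum gains on passing to m+1. *)
have := @telescope_sumr _ 0 m.+1 G (leq0n _).
rewrite big_mkord -(eq_bigr _ (fun k _ => step k)).
rewrite sumrB -!big_distrr /= IH => tel.
have e1 : w m.+1 * (m.+1%:R * (N + b - m%:R)) =
      w m * ((m%:R + (a - b)) * (N - m%:R)) by exact: cutoff_coefS.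
rewrite [in RHS]coef_1mtXS [in RHS]big_ord_recr /=.
rewrite [\sum_(k < m.+2) _]big_ord_recr /= subnn.
set E := \sum_(i < m.+1) _; set P := \prod_(i < m) _; set C := coef_1mtX _ _.
have := nz m.
rewrite [al 0]coef_1mtX0 => nzm.
rewrite /G subnn [al 0]coef_1mtX0 in tel.
have nz2 : m.+1%:R * (N + b - m%:R) != 0 by rewrite mulf_neq0.
apply: (mulfI nz2).
have -> : m.+1%:R * (N + b - m%:R) * (C * ((m%:R - b) / m.+1%:R) *
   (P * ((N + a - m%:R) / (N + b - m%:R)))) = 
   (m%:R - b) * (N - m%:R + a) * (C * P) by field; rewrite ?nat1r ?natr1 nzm nz1.
rewrite !mul0r oppr0 subr0 in tel.
rewrite -/C -/P -/E -(@natr1 R m) in tel *.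
apply/eqP; rewrite -subr_eq0; apply/eqP.
move/eqP: tel; rewrite -subr_eq0 => /eqP <-; ring.
Qed.

(** * The sequence g and its averages *)

(** From A on, |f n| / g n is nonincreasing, so the sum of its values up to A bounds it
    everywhere. *)
Lemma ratio_bound (R : realType) (f g : nat -> R) (A : nat) :
  (forall n, 0 < g n) ->
  (forall n, (A <= n)%N -> `|f n.+1| * g n <= `|f n| * g n.+1) ->
  exists2 K : R, 0 <= K & forall n, `|f n| <= K * g n.
Proof.
move=> g0 fg; exists (\sum_(i < A.+1) `|f i| / g i).
  by apply: sumr_ge0 => i _; rewrite divr_ge0 // ltW.
set K := \sum_(i < _) _.
have small n : (n <= A)%N -> `|f n| <= K * g n.
  move=> nA; rewrite -ler_pdivrMr // /K (bigD1 (Ordinal (nA : (n < A.+1)%N))) //=.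
  by rewrite lerDl sumr_ge0 // => i _; rewrite divr_ge0 // ltW.
elim=> [|n IH]; first exact: small.
case: (leqP n.+1 A) => [|An]; first exact: small.
rewrite -(ler_pM2r (g0 n)); apply: le_trans (fg _ An) _.
by rewrite mulrAC ler_pM2r.
Qed.

(* gpos and gneg are the halves x >= 0 and x <= 0 (at -x) of the sequence g on
   the integers with g 0 = 1 and g x / g (x - 1) = (x + b) / (x + a);
   gshift N m is g (N - m). *)
Definition gpos (R : realType) (a b : R) (n : nat) : R :=
  \prod_(j < n) ((j.+1%:R + b) / (j.+1%:R + a)).

Definition gneg (R : realType) (a b : R) (n : nat) : R :=
  \prod_(j < n) ((a - j%:R) / (b - j%:R)).

Definition gshift (R : realType) (a b : R) (N m : nat) : R :=
  gpos a b N * \prod_(j < m) ((N%:R + a - j%:R) / (N%:R + b - j%:R)).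

Lemma gpos_gt0 (R : realType) (a b : R) n : 0 < b -> b < a -> 0 < gpos a b n.
Proof.
move=> b0 ba; apply: prodr_gt0 => j _.
by apply: divr_gt0; rewrite addr_gt0 // ?ltr0Sn // (lt_trans b0).
Qed.

Lemma gposS (R : realType) (a b : R) n :
  gpos a b n.+1 = gpos a b n * ((n.+1%:R + b) / (n.+1%:R + a)).
Proof. by rewrite /gpos big_ord_recr. Qed.

Lemma gpos_nincr (R : realType) (a b : R) m n : 0 < b -> b < a ->
  (m <= n)%N -> gpos a b n <= gpos a b m.
Proof.
move=> b0 ba /subnKC <-; elim: (n - m)%N => [|k IH]; first by rewrite addn0.
rewrite addnS gposS; apply: le_trans IH.
rewrite ger_pMr ?gpos_gt0 // ler_pdivrMr ?mul1r ?lerD2l ?(ltW ba) //.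
by rewrite addr_gt0 ?ltr0Sn // (lt_trans b0).
Qed.

Lemma gpos_le1 (R : realType) (a b : R) n : 0 < b -> b < a -> gpos a b n <= 1.
Proof.
by move=> b0 ba; have := gpos_nincr b0 ba (leq0n n); rewrite /gpos big_ord0.
Qed.

(** The factors with j < N cancel those of [gpos] from the top down; the factors with j >= N are
    those of [gneg]. *)
Lemma gshiftE (R : realType) (a b : R) N m : 0 < b -> b < a ->
  (forall j : nat, N%:R + b - j%:R != 0) ->
  gshift a b N m =
    if (m <= N)%N then gpos a b (N - m) else gneg a b (m - N).
Proof.
move=> b0 ba nz; elim: m => [|m IH].
  by rewrite /gshift big_ord0 mulr1 subn0.
rewrite /gshift big_ord_recr /= mulrA -/(gshift a b N m) IH.
have nzm := nz m.
case: ltngtP => [mN|Nm|->].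
- rewrite subnS.
  case E : (N - m)%N => [|k]; first by move: mN; rewrite -subn_gt0 E.
  have -> : N%:R = k.+1%:R + m%:R :> R by rewrite -natrD -E subnK // ltnW.
  rewrite /= gposS.
  have h1 : k.+1%:R + a != 0.
    by rewrite gt_eqF // addr_gt0 ?ltr0Sn // (lt_trans b0).
  have h2 : k.+1%:R + b != 0 by rewrite gt_eqF // addr_gt0 ?ltr0Sn.
  have e (x : R) : k.+1%:R + m%:R + x - m%:R = k.+1%:R + x by ring.
  rewrite !e -mulrA.
  rewrite [X in gpos _ _ _ * X](_ : _ = 1) ?mulr1 //.
  by field; rewrite nat1r h1 h2.
- rewrite (subSn (ltnW Nm)) /gneg big_ord_recr /= natrB ?(ltnW Nm) //.
  by congr (_ * (_ / _)); ring.
- rewrite subnn subSn // subnn /gneg big_ord1 /gpos big_ord0.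
  by rewrite mul1r; congr (_ / _) => /=; ring.
Qed.

(** For n > a the ratio of consecutive terms on the left is (n-a)/(n-b), and (n-a)(n+1+a) <=
    (n-b)(n+1+b) because x + x^2 increases for x > 0. *)
Lemma gneg_bound (R : realType) (a b : R) : 0 < b -> b < a ->
  (forall j : nat, b - j%:R != 0) ->
  exists2 K : R, 0 <= K & forall n, `|gneg a b n| <= K * gpos a b n.
Proof.
move=> b0 ba nz.
apply: (@ratio_bound _ _ _ (Num.truncn a).+1) => [n|n an]; first exact: gpos_gt0.
have an' : a < n%:R.
  apply: lt_le_trans (_ : (Num.truncn a).+1%:R <= _); last by rewrite ler_nat.
  by apply: truncnS_gt.
rewrite gposS [gneg _ _ n.+1]big_ord_recr /= -/(gneg a b n) normrM -!mulrA.
rewrite ler_wpM2l // mulrC ler_pM2l ?gpos_gt0 //.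
rewrite normrM normfV ltr0_norm ?ltr0_norm ?subr_lt0 //; last exact: lt_trans an'.
have h1 : 0 < n.+1%:R + a by rewrite addr_gt0 ?ltr0Sn // (lt_trans b0).
rewrite ler_pdivrMr; last by lra.
rewrite mulrAC ler_pdivlMr // -natr1; nra.
Qed.

(** The indices are |N - m|, so each value of g occurs at most twice; the parts N < m and N >= m are
    bounded separately. *)
Lemma sum_shift_le (R : realType) (g : nat -> R) (L m : nat) :
  (forall n, 0 <= g n) -> {homo g : x y / (x <= y)%N >-> y <= x} ->
  \sum_(0 <= N < L) g (if (m <= N)%N then N - m else m - N)%N <=
  2 * \sum_(0 <= N < L) g N.
Proof.
move=> g0 gd.
have sub p : (p <= L)%N -> \sum_(0 <= N < p) g N <= \sum_(0 <= N < L) g N.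
  by move=> pL; rewrite (big_cat_nat (leq0n p) pL) /= lerDl sumr_ge0.
pose p := minn m L.
rewrite (big_cat_nat (leq0n p) (geq_minr m L)) /= mulr_natl mulr2n lerD //.
  apply: le_trans (sub p (geq_minr m L)).
  (* After reversal m - i is compared with p - i - 1, which is no larger. *)
  rewrite [leRHS]big_nat_rev /= add0n.
  apply: ler_sum_nat => i /andP[_ ip].
  have im : (i < m)%N by apply: leq_trans ip (geq_minl _ _).
  rewrite leqNgt im /=; apply: gd.
  rewrite subnS; apply: leq_trans (leq_pred _) _.
  by apply: leq_sub2r; exact: geq_minl.
rewrite /p; case: (leqP m L) => mL; last first.
  by rewrite big_geq // sumr_ge0.
rewrite -{1}[m]add0n big_addn; apply: le_trans (sub _ (leq_subr m L)).
by apply: ler_sum_nat => i _; rewrite leq_addl addnK.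
Qed.

(** This is the uniform bound on rho_L. The factor 1 + K covers both halves of g in terms of [gpos]
    at |N - m|, and 2 comes from [sum_shift_le]. *)
Lemma gshift_sum_bound (R : realType) (a b : R) : 0 < b -> b < a ->
  nonint b ->
  exists2 K : R, 0 <= K & forall m L,
    `|\sum_(0 <= N < L) gshift a b N m| <= K * \sum_(0 <= N < L) gpos a b N.
Proof.
move=> b0 ba nz.
have [|K K0 HK] := gneg_bound b0 ba; first by move=> j; have := nz 0%N j; rewrite add0r.
have K1 : 0 <= 1 + K by lra.
exists ((1 + K) * 2) => [|m L]; first by lra.
apply: le_trans (ler_norm_sum _ _ _) _.
rewrite -mulrA; apply: le_trans (_ : (1 + K) *
  \sum_(0 <= N < L) gpos a b (if (m <= N)%N then N - m else m - N)%N <= _).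
  rewrite mulr_sumr; apply: ler_sum_nat => N _; rewrite gshiftE //.
  case: ifP => _.
    rewrite gtr0_norm ?gpos_gt0 // ler_peMl ?(ltW (gpos_gt0 _ _ _)) //; lra.
  apply: le_trans (HK _) _; rewrite ler_wpM2r ?(ltW (gpos_gt0 _ _ _)) //; lra.
rewrite ler_wpM2l //; apply: sum_shift_le => [n|x y].
  by rewrite ltW ?gpos_gt0.
exact: gpos_nincr.
Qed.

(** For a <= b + 1 the product of [gpos] n and n+1+b is nondecreasing, hence at least 1 + b. As
    [gpos] <= 1, this leaves [gpos] n >= 1/(n+1). *)
Lemma sum_gpos_dvg (R : realType) (a b : R) : 0 < b -> b < a -> a <= b + 1 ->
  (fun L => \sum_(0 <= N < L) gpos a b N) @ \oo --> +oo.
Proof.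
move=> b0 ba ab1.
have low n : 1 + b <= gpos a b n * (n.+1%:R + b).
  elim: n => [|n IH]; first by rewrite /gpos big_ord0 mul1r.
  apply: le_trans IH _; rewrite gposS -mulrA ler_pM2l ?gpos_gt0 //.
  have p : 0 < n.+1%:R :> R by rewrite ltr0Sn.
  rewrite mulrAC ler_pdivlMr; last by lra.
  rewrite ler_pM2l; last by lra.
  rewrite -(@natr1 R n.+1); lra.
have harm : series (@harmonic R) @ \oo --> +oo.
  apply: nondecreasing_dvgn_lt; last exact: dvg_harmonic.
  apply/nondecreasing_seqP => n; rewrite seriesSr lerDl.
  by rewrite /harmonic /= invr_ge0.
apply: ger_cvgy harm.
near=> L; apply: ler_sum_nat => n _; rewrite /harmonic /=.
have p : 0 < n.+1%:R :> R by rewrite ltr0Sn.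
rewrite -[leLHS]mul1r ler_pdivrMr //.
have := low n; have := gpos_gt0 n b0 ba.
have := gpos_le1 n b0 ba.
nra.
Unshelve. all: by end_near.
Qed.

Lemma gshift_avg_cvg (R : realType) (a b : R) m : 0 < b -> b < a -> a <= b + 1 ->
  nonint b ->
  (fun L => (\sum_(0 <= N < L) gshift a b N m) / \sum_(0 <= N < L) gpos a b N)
    @ \oo --> (1 : R).
Proof.
move=> b0 ba ab1 nz.
pose D L := \sum_(0 <= N < L) gpos a b N.
(* C bounds the difference of numerator and denominator for every L >= m: they share L - m terms,
   leaving m terms of [gshift] and m terms of [gpos], each of the latter at most 1. *)
pose C := `|\sum_(0 <= N < m) gshift a b N m| + m%:R.
have C0 : 0 <= C by rewrite addr_ge0.
apply/cvgrPdist_le => e e0.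
have /cvgryPge/(_ ((C + 1) / e)) := sum_gpos_dvg b0 ba ab1.
move=> Dlarge; near=> L.
have DL : (C + 1) / e <= D L by near: L.
have DL0 : 0 < D L by apply: lt_le_trans DL; rewrite divr_gt0 //; lra.
have mL : (m <= L)%N by near: L; exact: nbhs_infty_ge.
rewrite distrC -(ler_pM2r DL0) -{1}[D L]gtr0_norm // -normrM mulrBl mul1r divfK ?gt_eqF //.
apply: le_trans (_ : C <= _); last first.
  rewrite ler_pdivrMr // mulrC in DL; lra.
rewrite (big_cat_nat (leq0n m) mL) /= -addrA.
apply: le_trans (ler_normD _ _) _; rewrite lerD //.
rewrite -{1}[m]add0n big_addn.
rewrite (eq_bigr (gpos a b)); last first.
  by move=> i _; rewrite gshiftE // leq_addl addnK.
rewrite /D (big_cat_nat (leq0n (L - m)%N) (leq_subr m L)) /= opprD addrA subrr sub0r normrN.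
apply: le_trans (ler_norm_sum _ _ _) _.
apply: le_trans (_ : \sum_(L - m <= i < L) 1 <= _).
  apply: ler_sum_nat => i _; rewrite gtr0_norm ?gpos_gt0 //; exact: gpos_le1.
by rewrite sumr_const_nat subKn.
Unshelve. all: by end_near.
Qed.

(** * Averaging and dominated convergence for scalar series *)

Definition cvg_ge0 (R : realType) (f : nat -> R) : Prop :=
  exists2 v : R, 0 <= v & series f @ \oo --> v.

Lemma coef_1mtX_ge0 (R : realType) (c : R) n : c <= 0 -> 0 <= coef_1mtX c n.
Proof.
move=> c0; elim: n => [|n IH]; first by rewrite coef_1mtX0.
rewrite coef_1mtXS mulr_ge0 // divr_ge0 //.
by rewrite subr_ge0 (le_trans c0).
Qed.

Lemma cutoff_coef_eq0 (R : realType) (a b : R) N k : (N < k)%N ->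
  cutoff_coef a b N%:R k = 0.
Proof.
move=> Nk; rewrite /cutoff_coef (bigD1 (Ordinal Nk)) //=.
by rewrite subrr !mul0r mulr0.
Qed.

Lemma cutoff_coef_ge0 (R : realType) (a b : R) N k : 0 < b -> b < a ->
  0 <= cutoff_coef a b N%:R k.
Proof.
move=> b0 ba; case: (ltnP N k) => [/cutoff_coef_eq0 -> //|kN].
rewrite /cutoff_coef mulr_ge0 ?coef_1mtX_ge0 ?subr_le0 ?(ltW ba) //.
apply: prodr_ge0 => j _.
have jN : j%:R <= N%:R :> R by rewrite ler_nat (leq_trans _ kN) // ltnW.
by rewrite divr_ge0; lra.
Qed.

(** One factor vanishes for k > N and the other for k > m. A range of k common to all N < L permits
    the exchange of sums in [weighted_differences]. *)
Lemma cutoff_conv_trunc (R : realType) (a b : R) N L m : nonint b -> (N < L)%N ->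
  \sum_(0 <= k < L) cutoff_coef a b N%:R k *
    (if (k <= m)%N then coef_1mtX a (m - k) else 0) =
  coef_1mtX b m * \prod_(j < m) ((N%:R + a - j%:R) / (N%:R + b - j%:R)).
Proof.
move=> bZ NL; rewrite -cutoff_conv; last exact: bZ.
pose F k := cutoff_coef a b N%:R k *
  (if (k <= m)%N then coef_1mtX a (m - k) else 0).
have F0 p q n : (N < p)%N || (m < p)%N -> \sum_(p <= k < q | n k) F k = 0.
  move=> Np; rewrite big_nat_cond big1 // => k /andP[/andP[pk _] _].
  case/orP: Np => h; first by rewrite /F cutoff_coef_eq0 ?mul0r ?(leq_trans h).
  by rewrite /F leqNgt (leq_trans h) //= mulr0.
transitivity (\sum_(0 <= k < maxn L m.+1) F k).
  by rewrite (big_cat_nat (leq0n _) (leq_maxl L m.+1)) /= [X in _ + X]F0 ?NL ?addr0.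
rewrite (big_cat_nat (leq0n _) (leq_maxr L m.+1)) /= [X in _ + X]F0 ?leqnn ?orbT // addr0.
rewrite big_mkord; apply: eq_bigr => k _.
by rewrite /F -ltnS ltn_ord.
Qed.

(** The sum is that of W k * v k over k < L, with both factors nonnegative. Only finitely many k
    occur, so the series in m combine termwise. *)
Lemma weighted_differences (R : realType) (a b : R) (u : nat -> R) L :
  0 < b -> b < a -> nonint b ->
  (forall k, cvg_ge0 (fun n => coef_1mtX a n * u (n + k)%N)) ->
  cvg_ge0 (fun m =>
    coef_1mtX b m * u m * \sum_(0 <= N < L) gshift a b N m).
Proof.
move=> b0 ba bZ au.
have [v hv] : exists v : nat -> R, forall k, 0 <= v k /\
    series (fun n => coef_1mtX a n * u (n + k)%N) @ \oo --> v k.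
  suff /boolp.choice[v hv] : forall k, exists vk : R, 0 <= vk /\
    series (fun n => coef_1mtX a n * u (n + k)%N) @ \oo --> vk by exists v.
  by move=> k; have [w w0 hw] := au k; exists w.
(* The coefficients are delayed by k, so that every v k is a series in the same terms u m. *)
pose al k m := if (k <= m)%N then coef_1mtX a (m - k) else 0.
pose W k := \sum_(0 <= N < L) gpos a b N * cutoff_coef a b N%:R k.
have W0 k : 0 <= W k.
  by apply: sumr_ge0 => N _; rewrite mulr_ge0 ?cutoff_coef_ge0 // ltW ?gpos_gt0.
have alv k : series (fun m => al k m * u m) @ \oo --> v k.
  rewrite -(cvg_shiftn k).
  rewrite (_ : (fun n => _) = series (fun n => coef_1mtX a n * u (n + k)%N)).
    by have [] := hv k.
  apply/funext => n; rewrite /series /= [LHS](big_cat_nat (leq0n k) (leq_addl n k)) /=.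
  rewrite [X in X + _]big_nat_cond big1 ?add0r; last first.
    by move=> i /andP[/andP[_ ik] _]; rewrite /al leqNgt ik mul0r.
  rewrite -{1}[k]add0n big_addn addnK; apply: eq_bigr => i _.
  by rewrite /al leq_addl addnK.
exists (\sum_(0 <= k < L) W k * v k).
  by apply: sumr_ge0 => k _; rewrite mulr_ge0 //; case: (hv k).
rewrite (_ : series _ =
    fun n => \sum_(0 <= k < L) W k * series (fun m => al k m * u m) n).
  apply: cvg_big => [|k _]; first exact: add_continuous.
  by apply: cvgMl_tmp; exact: alv.
apply/funext => n; rewrite /series /=.
under [RHS]eq_bigr do rewrite mulr_sumr.
rewrite exchange_big /=; apply: eq_bigr => m _.
under [RHS]eq_bigr do rewrite mulrA.
rewrite -mulr_suml mulrAC; congr (_ * _).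
rewrite /W mulr_sumr; under [RHS]eq_bigr do rewrite mulr_suml.
rewrite exchange_big /=; apply: eq_big_nat => N /andP[_ NL].
rewrite /gshift mulrCA -(cutoff_conv_trunc a m bZ NL) mulr_sumr.
by apply: eq_bigr => k _; rewrite mulrA.
Qed.

(** Domination by K |c n| allows L to tend to infinity under the sum. *)
Lemma tannery_ge0 (R : realType) (c : nat -> R) (K : R)
    (rho : nat -> nat -> R) :
  0 <= K -> cvgn (series (fun n => `|c n|)) ->
  (forall L n, `|rho L n| <= K) ->
  (forall n, rho ^~ n @ \oo --> (1 : R)) ->
  (forall L, cvg_ge0 (fun n => c n * rho L n)) ->
  cvg_ge0 c.
Proof.
move=> K0 cc rhoK rho1 pos.
have cs : cvgn (series c) by exact: normed_cvg.
exists (limn (series c)) => //.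
apply/ler_addgt0Pr => e e0.
(* The terms from p on cost K d in the weighted sums and d in the limit, together e. *)
pose d := e / (K + 1); have d0 : 0 < d by rewrite divr_gt0 //; lra.
have /cauchy_cvgP/cauchy_seriesP/(_ _ d0) := cc.
case=> -[A B] /= [[p1 _ Ap] [p2 _ Bp]] AB.
pose p := maxn p1 p2.
have tail n : (p <= n)%N -> \sum_(p <= i < n) `|c i| <= d.
  move=> pn; rewrite ltW // (le_lt_trans (ler_norm _)) //.
  apply: (AB (p, n)); split => /=; first by apply: Ap; exact: leq_maxl.
  by apply: Bp; apply: leq_trans pn; exact: leq_maxr.
have head L : 0 <= \sum_(0 <= i < p) c i * rho L i + K * d.
  have [v v0 hv] := pos L; apply: le_trans v0 _.
  apply: (cvgr_to_le hv); near=> n.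
  have pn : (p <= n)%N by near: n; exact: nbhs_infty_ge.
  rewrite /series /= (big_cat_nat (leq0n p) pn) /= lerD2l.
  apply: le_trans (ler_norm _) _; apply: le_trans (ler_norm_sum _ _ _) _.
  apply: le_trans (_ : K * \sum_(p <= i < n) `|c i| <= _); last first.
    by rewrite ler_wpM2l // tail.
  rewrite mulr_sumr; apply: ler_sum => i _.
  by rewrite normrM mulrC ler_wpM2r.
have head1 : 0 <= \sum_(0 <= i < p) c i * 1 + K * d.
  have hc : (fun L => \sum_(0 <= i < p) c i * rho L i + K * d) @ \oo -->
      \sum_(0 <= i < p) c i * 1 + K * d.
    apply: cvgD; last exact: cvg_cst.
    apply: cvg_big => [|i _]; first exact: add_continuous.
    by apply: cvgMl_tmp; exact: rho1.
  by apply: (cvgr_to_ge hc); near=> L; exact: head.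
have lims : \sum_(0 <= i < p) c i - d <= limn (series c).
  apply: (cvgr_to_ge cs); near=> n.
  have pn : (p <= n)%N by near: n; exact: nbhs_infty_ge.
  rewrite /series /= (big_cat_nat (leq0n p) pn) /= lerD2l lerNl.
  apply: le_trans (ler_norm _) _; rewrite normrN.
  by apply: le_trans (ler_norm_sum _ _ _) _; exact: tail.
rewrite -mulr_suml mulr1 in head1.
have : e = K * d + d by rewrite /d -[X in _ + X]mul1r -mulrDl mulrC divfK //; lra.
lra.
Unshelve. all: by end_near.
Qed.

Lemma difference_step (R : realType) (a b : R) (u : nat -> R) :
  0 < b -> b < a -> a <= b + 1 -> nonint b -> (forall n, 0 <= u n) ->
  cvgn (series (fun n => `|coef_1mtX b n| * u n)) ->
  (forall k, cvg_ge0 (fun n => coef_1mtX a n * u (n + k)%N)) ->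
  cvg_ge0 (fun n => coef_1mtX b n * u n).
Proof.
move=> b0 ba ab1 bZ u0 bu au.
have [K K0 HK] := gshift_sum_bound b0 ba bZ.
pose D L := \sum_(0 <= N < L) gpos a b N.
have D0 L : 0 <= D L by apply: sumr_ge0 => N _; rewrite ltW ?gpos_gt0.
apply: (@tannery_ge0 _ _ K
  (fun L n => (\sum_(0 <= N < L) gshift a b N n) / D L)) => //.
- rewrite (_ : (fun n => _) = (fun n => `|coef_1mtX b n| * u n)) //.
  by apply/funext => n; rewrite normrM (ger0_norm (u0 _)).
- move=> L n; rewrite normrM normfV (ger0_norm (D0 L)).
  (* The denominator vanishes for L = 0; the quotient is then 0, since 0 is its own inverse. *)
  have [->|DL] := eqVneq (D L) 0; first by rewrite invr0 mulr0.
  by rewrite ler_pdivrMr ?HK // lt_def DL D0.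
- by move=> n; exact: gshift_avg_cvg.
move=> L; have [v v0 hv] := weighted_differences L b0 ba bZ au.
exists (v / D L); first by rewrite divr_ge0.
rewrite (_ : series _ = fun n => series (fun m => coef_1mtX b m * u m *
  \sum_(0 <= N < L) gshift a b N m) n / D L); last first.
  apply/funext => n; rewrite /series /= mulr_suml.
  by apply: eq_bigr => i _; rewrite mulrA.
by apply: cvgMr_tmp; exact: hv.
Qed.

(** * Comparison of exponents and the descent *)

Lemma nonintDn (R : realType) (b : R) (k : nat) : nonint b -> nonint (b + k%:R).
Proof.
move=> bZ N j; have := bZ (N + k)%N j; rewrite natrD.
by rewrite (_ : N%:R + k%:R + b - j%:R = N%:R + (b + k%:R) - j%:R) //; ring.
Qed.

Lemma nonint_notint (R : realType) (b : R) : b \isn't a Num.int -> nonint b.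
Proof.
move=> bZ N j; apply: contra bZ; rewrite subr_eq0 eq_sym addrC -subr_eq => /eqP <-.
by rewrite rpredB ?natr_int.
Qed.

Lemma coef_1mtX_neq0 (R : realType) (b : R) n : nonint b -> coef_1mtX b n != 0.
Proof.
move=> bZ; elim: n => [|n IH]; first by rewrite coef_1mtX0 oner_neq0.
rewrite coef_1mtXS mulf_neq0 // mulf_neq0 ?invr_neq0 ?pnatr_eq0 //.
by have := bZ 0%N n; rewrite add0r -oppr_eq0 opprB.
Qed.

(** For n > a the ratios of consecutive terms are (n-a)/(n+1) <= (n-b)/(n+1). This carries absolute
    convergence from b up to b + j in the descent. *)
Lemma coef_1mtX_bound (R : realType) (a b : R) : nonint b -> b <= a ->
  exists2 K : R, 0 <= K & forall n, `|coef_1mtX a n| <= K * `|coef_1mtX b n|.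
Proof.
move=> bZ ba; apply: (@ratio_bound _ _ _ (Num.truncn a).+1) => [n|n an].
  by rewrite normr_gt0 coef_1mtX_neq0.
have an' : a < n%:R.
  apply: lt_le_trans (_ : (Num.truncn a).+1%:R <= _); last by rewrite ler_nat.
  exact: truncnS_gt.
rewrite /= !coef_1mtXS; move: (coef_1mtX a n) (coef_1mtX b n) => x y.
rewrite !normrM -mulrA ler_wpM2l // mulrC ler_wpM2l // ler_wpM2r //.
rewrite !ger0_norm; lra.
Qed.

(** The ratio (n-b)/(n+1) of consecutive coefficients is nonnegative once n >= b. *)
Lemma coef_1mtX_eventual_sign (R : realType) (b : R) :
  exists s : bool, exists A : nat, forall n, (A <= n)%N ->
    coef_1mtX b n = (-1) ^+ s * `|coef_1mtX b n|.
Proof.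
have := truncnS_gt b; move: _.+1 => A bA; exists (coef_1mtX b A < 0), A.
move=> n /subnKC <-; elim: (n - A)%N => [|k IH]; first by rewrite addn0 [LHS]realEsign ?num_real.
rewrite addnS coef_1mtXS normrM [RHS]mulrA -IH; congr (_ * _).
rewrite ger0_norm // divr_ge0 // subr_ge0 ltW //.
apply: lt_le_trans (_ : A%:R <= _); first exact: bA.
by rewrite ler_nat leq_addr.
Qed.

Lemma cvg_series_bounded (R : realType) (f g : nat -> R) (K : R) :
  (forall n, 0 <= f n <= K * g n) -> cvgn (series g) -> cvgn (series f).
Proof.
move=> fg gc; apply: (@series_le_cvg _ f (fun n => K * g n)).
- by move=> n; case/andP: (fg n).
- by move=> n; case/andP: (fg n) => h1 h2; exact: le_trans h1 h2.
- by move=> n; case/andP: (fg n).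
exact: (@is_cvg_seriesZ _ g K gc).
Qed.

Lemma difference_descent (R : realType) (a b : R) (u : nat -> R) :
  0 < b -> b < a -> nonint b -> (forall n, 0 <= u n) ->
  (forall k, cvgn (series (fun n => `|coef_1mtX b n| * u (n + k)%N))) ->
  (forall k, cvg_ge0 (fun n => coef_1mtX a n * u (n + k)%N)) ->
  cvg_ge0 (fun n => coef_1mtX b n * u n).
Proof.
move=> b0 ba bZ u0 bu au.
(* All shifts k are carried along, because the next step down needs them. *)
have step c (j : nat) : b + j%:R < c -> c <= b + j%:R + 1 ->
    (forall k, cvg_ge0 (fun n => coef_1mtX c n * u (n + k)%N)) ->
    forall k, cvg_ge0 (fun n => coef_1mtX (b + j%:R) n * u (n + k)%N).
  move=> bc cb cu k.
  apply: (@difference_step _ c (b + j%:R) (fun n => u (n + k)%N)) => //.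
  - by rewrite ltr_wpDr.
  - exact: nonintDn.
  - have bj : b <= b + j%:R by rewrite lerDl.
    have [K K0 HK] := coef_1mtX_bound bZ bj.
    apply: (cvg_series_bounded (K := K) _ (bu k)) => n.
    by rewrite mulr_ge0 //= mulrA ler_wpM2r.
  move=> i; have [v v0 hv] := cu (i + k)%N; exists v => //.
  by under eq_fun do rewrite -addnA.
(* The first step, from a to b + j, has length at most 1; all later ones have length exactly 1. *)
have [j jc cj] : exists2 j : nat, b + j%:R < a & a <= b + j%:R + 1.
  have ex : exists j : nat, a <= b + j%:R + 1.
    exists (Num.truncn a); have := truncnS_gt a; rewrite -natr1; lra.
  case: (ex_minnP ex) => j ja jmin; exists j => //.
  case: j ja jmin => [|j] ja jmin; first by rewrite addr0.
  rewrite ltNge; apply/negP => aj.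
  by have := jmin j; rewrite ltnn -addrA natr1 => /(_ aj).
have down (i : nat) : (i <= j)%N ->
    forall k, cvg_ge0 (fun n => coef_1mtX (b + (j - i)%:R) n * u (n + k)%N).
  elim: i => [_|i IH ij]; first by rewrite subn0; exact: (step _ _ jc cj au).
  have e : (j - i)%N = (j - i.+1).+1 by rewrite subnS prednK // subn_gt0.
  apply: step (IH (ltnW ij)); rewrite e -natr1 addrA ?lexx //; lra.
have := down j (leqnn j) 0%N; rewrite subnn addr0.
by under eq_fun do rewrite addn0.
Qed.

(** * The real inner product of H *)

Lemma ReD (R : rcfType) (x y : R[i]) :
  complex.Re (x + y) = complex.Re x + complex.Re y.
Proof. by case: x y => ? ? [? ?]. Qed.

Section RealInner.
Context {R : realType} {H : hilbertType R}.
Implicit Types (x y z : H) (r : R).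

(** The norm of H takes values in R[i]; this is the same number in R. *)
Definition rnorm x : R := complex.Re `|x|.
Definition rinner x y : R := complex.Re (inner x y).

Lemma rnormE x : `|x| = (rnorm x)%:C.
Proof. by rewrite /rnorm RRe_real // realE normr_ge0. Qed.

Lemma rnorm_ge0 x : 0 <= rnorm x.
Proof. by rewrite -ler0c -rnormE. Qed.

Lemma inner_rnorm x : inner x x = (rnorm x ^+ 2)%:C.
Proof. by rewrite inner_norm rnormE -rmorphXn. Qed.

Lemma rinner_rnorm x : rinner x x = rnorm x ^+ 2.
Proof. by rewrite /rinner inner_rnorm. Qed.

Lemma innerC x y : inner x y = conjC (inner y x).
Proof. by rewrite hermC expr0 mul1r. Qed.

Lemma rinnerC x y : rinner x y = rinner y x.
Proof. by rewrite /rinner innerC; case: (inner y x). Qed.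

Lemma innerDl x y z : inner (x + y) z = inner x z + inner y z.
Proof. exact: linearDl. Qed.

Lemma rinnerDl x y z : rinner (x + y) z = rinner x z + rinner y z.
Proof. by rewrite /rinner innerDl ReD. Qed.

Lemma rinnerDr x y z : rinner z (x + y) = rinner z x + rinner z y.
Proof. by rewrite rinnerC rinnerDl ![rinner _ z]rinnerC. Qed.

Lemma innerZl (a : R[i]) x y : inner (a *: x) y = a * inner x y.
Proof. by rewrite linearZl_LR. Qed.

Lemma rinnerZl r x y : rinner (r%:C *: x) y = r * rinner x y.
Proof.
by rewrite /rinner innerZl; case: (inner x y) => u v /=; rewrite mul0r subr0.
Qed.

Lemma rinnerZr r x y : rinner x (r%:C *: y) = r * rinner x y.
Proof. by rewrite rinnerC rinnerZl rinnerC. Qed.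

Lemma rinner_i x y : rinner ('i *: x) y = - complex.Im (inner x y).
Proof. by rewrite /rinner innerZl mulrC ReiNIm. Qed.

Lemma rnormZ (a : R[i]) x : rnorm (a *: x) = complex.Re `|a| * rnorm x.
Proof.
rewrite /rnorm normrZ [`|x|]rnormE; case: `|a| => u v /=.
by rewrite mulr0 subr0.
Qed.

Lemma rnorm_i x : rnorm ('i *: x) = rnorm x.
Proof. by rewrite rnormZ normc_def /= expr0n expr1n /= add0r sqrtr1 mul1r. Qed.

Lemma rinner_le x y : `|rinner x y| <= rnorm x * rnorm y.
Proof.
have key t : 0 <= rnorm x ^+ 2 + 2 * t * rinner x y + t ^+ 2 * rnorm y ^+ 2.
  have : 0 <= rinner (x + t%:C *: y) (x + t%:C *: y).
    by rewrite rinner_rnorm sqr_ge0.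
  rewrite !(rinnerDl, rinnerDr) !rinnerZr !rinnerZl !rinner_rnorm.
  rewrite [rinner y x]rinnerC; nra.
have [y0|y0] := eqVneq (rnorm y) 0.
  suff -> : rinner x y = 0 by rewrite normr0 y0 mulr0.
  have [//|r0] := eqVneq (rinner x y) 0.
  (* At this t the quadratic, linear when y has norm 0, equals -1. *)
  have := key (- (rnorm x ^+ 2 + 1) / (2 * rinner x y)).
  rewrite y0 expr0n mulr0 addr0.
  have -> : 2 * (- (rnorm x ^+ 2 + 1) / (2 * rinner x y)) * rinner x y =
    - (rnorm x ^+ 2 + 1) by field.
  lra.
have yp : 0 < rnorm y by rewrite lt_def y0 rnorm_ge0.
rewrite -ler_sqr ?nnegrE ?mulr_ge0 ?rnorm_ge0 // real_normK ?num_real //.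
(* This t minimises the quadratic. *)
have := key (- rinner x y / rnorm y ^+ 2).
have -> : rnorm x ^+ 2 + 2 * (- rinner x y / rnorm y ^+ 2) * rinner x y +
  (- rinner x y / rnorm y ^+ 2) ^+ 2 * rnorm y ^+ 2 =
  rnorm x ^+ 2 - rinner x y ^+ 2 / rnorm y ^+ 2 by field.
by rewrite subr_ge0 ler_pdivrMr ?exprn_gt0 // exprMn.
Qed.

Lemma rinner_inj y z : (forall x, rinner x y = rinner x z) -> y = z.
Proof.
move=> e; apply/eqP; rewrite -subr_eq0 -normr_eq0 rnormE.
suff : rnorm (y - z) ^+ 2 == 0 by rewrite sqrf_eq0 => /eqP ->.
rewrite -rinner_rnorm rinnerDr e -rinnerDr subrr.
by rewrite rinnerC -(scale0r (0 : H)) (rinnerZl 0) mul0r.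
Qed.

(** The imaginary part of f x is minus the real part of f at i x, so the real part determines f. *)
Lemma innerP (f : H -> R[i]) z :
  (forall a x, f (a *: x) = a * f x) ->
  (forall x, complex.Re (f x) = rinner x z) -> forall x, f x = inner x z.
Proof.
move=> fZ fz x; apply/eqP; rewrite eq_complex; apply/andP; split.
  by rewrite fz.
by rewrite -eqr_opp -rinner_i -fz fZ mulrC ReiNIm.
Qed.

End RealInner.

(** * Completeness and Riesz representation *)

Section Riesz.
Context {R : realType} {H : hilbertType R}.
Implicit Types (x y z : H) (T S : bounded_op H).

Lemma cvg_rnorm (F : nat -> H) z : F @ \oo --> z ->
  forall e : R, 0 < e -> \forall n \near \oo, rnorm (z - F n) <= e.
Proof.
move=> /cvgrPdist_le Fz e e0; have := Fz e%:C; rewrite ltcR => /(_ e0).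
by apply: filterS => n; rewrite rnormE lecR.
Qed.

Lemma cvg_rinner (F : nat -> H) z x : F @ \oo --> z ->
  (fun n => rinner x (F n)) @ \oo --> rinner x z.
Proof.
move=> Fz; apply/cvgrPdist_le => e e0.
have x1 : 0 < rnorm x + 1 by rewrite ltr_wpDl // rnorm_ge0.
have e1 : 0 < e / (rnorm x + 1) by rewrite divr_gt0.
have := cvg_rnorm Fz e1; apply: filterS => n hn.
rewrite (_ : rinner x z - rinner x (F n) = rinner x (z - F n)); last first.
  by apply/eqP; rewrite subr_eq -rinnerDr subrK.
apply: le_trans (rinner_le _ _) _.
apply: le_trans (_ : (rnorm x + 1) * (e / (rnorm x + 1)) <= _).
  by apply: ler_pM; rewrite ?rnorm_ge0 // lerDl.
by rewrite mulrC divfK // gt_eqF.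
Qed.

Lemma cauchy_rnorm (F : nat -> H) :
  (forall e : R, 0 < e -> exists N : nat, forall m n : nat,
    (N <= m)%N -> (N <= n)%N -> rnorm (F m - F n) < e) ->
  exists z, F @ \oo --> z.
Proof.
move=> FC; suff /cauchy_cvgP : cauchy (F @ \oo) by exists (lim (F @ \oo)).
apply/cauchy_ballP => e e0.
(* In the order of R[i], 0 < e makes e real. *)
have eE : e = (complex.Re e)%:C by rewrite RRe_real // realE ltW.
have e0' : 0 < complex.Re e by rewrite -ltcR -eE.
have [N HN] := FC _ e0'.
exists ([set x | exists2 m, (N <= m)%N & x = F m], [set x | exists2 m, (N <= m)%N & x = F m]).
  by split; exists N => // m Nm; exists m.
move=> [x y] /= [[m Nm ->] [n Nn ->]].
by rewrite -ball_normE /= rnormE eE ltcR; exact: HN.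
Qed.

Lemma rnorm_parallelogram x y :
  rnorm (x + y) ^+ 2 + rnorm (x - y) ^+ 2 = 2 * rnorm x ^+ 2 + 2 * rnorm y ^+ 2.
Proof.
have eN : - y = (-1)%:C *: y by rewrite rmorphN1 scaleN1r.
rewrite -!rinner_rnorm eN !(rinnerDl, rinnerDr, rinnerZl, rinnerZr); ring.
Qed.

(* The representing vector minimises the functional |x|^2 - 2 g(x). *)
Lemma real_riesz (g : H -> R) (M : R) :
  (forall x y, g (x + y) = g x + g y) ->
  (forall (t : R) x, g (t%:C *: x) = t * g x) ->
  (forall x, `|g x| <= M * rnorm x) ->
  exists z, forall x, g x = rinner x z.
Proof.
move=> gD gZ gM.
pose phi x := rnorm x ^+ 2 - 2 * g x.
have phi_ge x : - M ^+ 2 <= phi x.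
  have := gM x; have := ler_norm (g x).
  by have := sqr_ge0 (rnorm x - M); rewrite /phi; nra.
have inf_phi : has_inf (range phi).
  split; first by exists (phi 0); exists 0.
  by exists (- M ^+ 2) => _ [x _ <-].
pose m := inf (range phi).
have m_le x : m <= phi x by apply: ge_inf; [case: inf_phi|exists x].
have /boolp.choice[F HF] : forall n : nat, exists x, phi x < m + n.+1%:R^-1.
  move=> n; have n0 : 0 < n.+1%:R^-1 :> R by rewrite invr_gt0 ltr0Sn.
  by have [_ [x _ <-] h] := inf_adherent n0 inf_phi; exists x.
(* Parallelogram law, with phi at the midpoint at least m; minimising sequences are therefore
   Cauchy. *)
have near_min x y (e : R) : phi x <= m + e -> phi y <= m + e ->
    rnorm (x - y) ^+ 2 <= 4 * e.
  move=> hx hy; have h := m_le ((2^-1)%:C *: (x + y)).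
  have e1 : phi ((2^-1)%:C *: (x + y)) =
      4^-1 * rnorm (x + y) ^+ 2 - (g x + g y).
    by rewrite /phi gZ gD -rinner_rnorm rinnerZl rinnerZr rinner_rnorm; field.
  have := rnorm_parallelogram x y.
  move: hx hy h; rewrite e1 /phi; lra.
have [z Fz] : exists z, F @ \oo --> z.
  apply: cauchy_rnorm => e e0.
  pose N := Num.truncn (4 / e ^+ 2); exists N.+1 => i j Ni Nj.
  have e20 : 0 < e ^+ 2 by rewrite exprn_gt0.
  have small k : (N.+1 <= k)%N -> phi (F k) <= m + N.+2%:R^-1.
    move=> Nk; apply: le_trans (ltW (HF k)) _.
    by rewrite lerD2l lef_pV2 ?posrE ?ltr0Sn // ler_nat.
  have := near_min _ _ _ (small _ Ni) (small _ Nj) => h.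
  rewrite -(@ltr_pXn2r _ 2) ?nnegrE ?rnorm_ge0 ?(ltW e0) //.
  apply: le_lt_trans h _; rewrite ltr_pdivrMr ?ltr0Sn // mulrC -ltr_pdivrMr //.
  by apply: lt_trans (truncnS_gt _) _; rewrite ltr_nat.
exists z => x.
(* Compare phi at F n + t x, at least m, with phi (F n) < m + 1/(n+1), and let n grow. *)
have quad t : 0 <= t ^+ 2 * rnorm x ^+ 2 + 2 * t * (rinner x z - g x).
  have lim_t : (fun n => t ^+ 2 * rnorm x ^+ 2 +
      2 * t * (rinner x (F n) - g x) + harmonic n) @ \oo -->
      t ^+ 2 * rnorm x ^+ 2 + 2 * t * (rinner x z - g x) + 0.
    apply: cvgD; last exact: cvg_harmonic.
    apply: cvgD; first exact: cvg_cst.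
    apply: cvgMl_tmp; apply: cvgB; last exact: cvg_cst.
    exact: cvg_rinner.
  rewrite addr0 in lim_t; apply: (cvgr_to_ge lim_t).
  near=> n; have := m_le (F n + t%:C *: x); have := HF n.
  rewrite /phi /harmonic /= gD gZ -!rinner_rnorm.
  rewrite !(rinnerDl, rinnerDr) !rinnerZr !rinnerZl [rinner (F n) x]rinnerC.
  rewrite !rinner_rnorm.
  by move: (n.+1%:R^-1); clearbody m; move=> h; lra.
(* This t makes the quadratic negative unless d = 0; the added 1 keeps the denominator positive for
   x = 0. *)
pose d := rinner x z - g x; pose t := - d / (rnorm x ^+ 2 + 1).
have X0 : 0 < rnorm x ^+ 2 + 1 by rewrite ltr_wpDl // sqr_ge0.
have := quad t; rewrite -/d.
have -> : t ^+ 2 * rnorm x ^+ 2 + 2 * t * d =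
    - (d ^+ 2 * (rnorm x ^+ 2 + 2) / (rnorm x ^+ 2 + 1) ^+ 2).
  by rewrite /t; field; rewrite gt_eqF.
rewrite oppr_ge0 pmulr_lle0 ?invr_gt0 ?exprn_gt0 // pmulr_lle0; last by lra.
rewrite -[_ <= 0]andbT -(sqr_ge0 d) -eq_le sqrf_eq0 subr_eq0 => /eqP ->.
by [].
Unshelve. all: by end_near.
Qed.

End Riesz.

(** * Adjoints and strong operator sums *)

Section Operators.
Context {R : realType} {H : hilbertType R}.
Implicit Types (x y z : H) (T S : bounded_op H).

Lemma riesz (f : H -> R[i]) (M : R) :
  (forall x y, f (x + y) = f x + f y) -> (forall a x, f (a *: x) = a * f x) ->
  (forall x, `|f x| <= M%:C * `|x|) ->
  exists z, forall x, f x = inner x z.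
Proof.
move=> fD fZ fM.
have [||x|z hz] := @real_riesz _ _ (fun x => complex.Re (f x)) M.
- by move=> x y; rewrite fD ReD.
- by move=> t x; rewrite fZ; case: (f x) => u v /=; rewrite mul0r subr0.
- rewrite -lecR rmorphM /= -rnormE; apply: le_trans (normc_ge_Re _) (fM x).
by exists z => x; apply: innerP.
Qed.

Lemma bounded_op_rnorm T : exists2 M : R, 0 <= M &
  forall x, rnorm (T x) <= M * rnorm x.
Proof.
have [M HM] := bounded_opP T; exists `|M| => // x.
have := HM x; rewrite !rnormE -rmorphM lecR => h; apply: le_trans h _.
by rewrite ler_wpM2r ?rnorm_ge0 ?ler_norm.
Qed.

Lemma bounded_op_exists (f : H -> H) (M : R) :
  linear f -> (forall x, rnorm (f x) <= M * rnorm x) ->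
  exists S, S =1 f.
Proof.
move=> flin fM.
pose L := GRing.isLinear.Build R[i] H H *:%R f flin.
pose F : {linear H -> H} := HB.pack f L.
have FM : exists M : R, forall x : H, `|F x| <= M%:C * `|x|.
  by exists M => x; rewrite !rnormE -rmorphM lecR.
by exists (BoundedOp FM).
Qed.

Lemma innerDr x y z : inner z (x + y) = inner z x + inner z y.
Proof. exact: linearDr. Qed.

Lemma innerZr (a : R[i]) x y : inner x (a *: y) = conjC a * inner x y.
Proof. by rewrite innerC innerZl rmorphM /= -innerC. Qed.

Lemma inner_inj y z : (forall x, inner x y = inner x z) -> y = z.
Proof. by move=> h; apply: rinner_inj => x; rewrite /rinner h. Qed.

(** The real and imaginary parts are bounded separately, whence the 2; boundedness is all that
    [riesz] asks for. *)
Lemma inner_le x y : `|inner x y| <= (2 * rnorm x * rnorm y)%:C.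
Proof.
rewrite normc_def lecR; set u := complex.Re _; set v := complex.Im _.
have hu : `|u| <= rnorm x * rnorm y by exact: rinner_le.
have hv : `|v| <= rnorm x * rnorm y.
  by rewrite -normrN -rinner_i; apply: le_trans (rinner_le _ _) _; rewrite rnorm_i.
apply: le_trans (_ : `|u| + `|v| <= _); last by rewrite -mulrA mulr_natl mulr2n lerD.
have uv0 : 0 <= `|u| + `|v| by rewrite addr_ge0.
rewrite -(ger0_norm uv0) -[leRHS]sqrtr_sqr; apply: ler_wsqrtr.
rewrite -(real_normK (num_real u)) -(real_normK (num_real v)).
by have := normr_ge0 u; have := normr_ge0 v; nra.
Qed.

(** Riesz gives the value at each w, and uniqueness of representing vectors gives linearity. The
    bound M of T is inherited, since |f u|^2 = <T (f u), u>. *)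
Lemma adjointP T x y : inner (T x) y = inner x (adjoint T y).
Proof.
suff [S HS] : exists S, forall x y, inner (T x) y = inner x (S y).
  by move: x y; exact: (@xgetPex _ T [set S : bounded_op H |
    forall x y : H, inner (T x) y = inner x (S y)]) (ex_intro _ S HS).
have [M M0 HM] := bounded_op_rnorm T.
have ex w : exists z, forall x, inner (T x) w = inner x z.
  apply: (@riesz (fun x => inner (T x) w) (2 * M * rnorm w)) =>  [u v|c u|u].
  - by rewrite linearD innerDl.
  - by rewrite linearZ innerZl.
  apply: le_trans (inner_le _ _) _.
  rewrite rnormE -rmorphM lecR [leRHS]mulrAC ler_wpM2r ?rnorm_ge0 //.
  by rewrite -mulrA ler_wpM2l ?HM.
have [f Hf] := boolp.choice ex.
have [||S HS] := @bounded_op_exists f M.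
- move=> c u v; apply: inner_inj => w.
  by rewrite innerDr innerZr -!Hf innerDr innerZr.
- move=> u; have [->|u0] := eqVneq (rnorm (f u)) 0.
    by rewrite mulr_ge0 ?rnorm_ge0.
  have fu : 0 < rnorm (f u) by rewrite lt_def u0 rnorm_ge0.
  rewrite -(ler_pM2l fu) -expr2 -rinner_rnorm /rinner -Hf.
  apply: le_trans (ler_norm _) _; apply: le_trans (rinner_le _ _) _.
  by rewrite mulrA [_ * M]mulrC ler_wpM2r ?rnorm_ge0.
by exists S => u v; rewrite HS Hf.
Qed.

Lemma iter_adjointP T n x y :
  inner (iter n T x) y = inner x (iter n (adjoint T) y).
Proof.
by elim: n y => //= n IH y; rewrite adjointP IH -iterSr.
Qed.

Lemma inner_iter_adjoint T n x :
  inner (iter n (adjoint T) (iter n T x)) x = (rnorm (iter n T x) ^+ 2)%:C.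
Proof.
by rewrite innerC -iter_adjointP -innerC inner_rnorm.
Qed.

Lemma iter_linear T n : linear (iter n T).
Proof.
by elim: n => [|n IH] c u v //=; rewrite (IH c u v) linearP.
Qed.

Lemma iter_bounded T n : exists2 M : R, 0 <= M &
  forall x, rnorm (iter n T x) <= M * rnorm x.
Proof.
have [M M0 HM] := bounded_op_rnorm T.
elim: n => [|n [K K0 HK]]; first by exists 1 => // x; rewrite mul1r.
exists (M * K) => [|x]; first by rewrite mulr_ge0.
by apply: le_trans (HM _) _; rewrite -mulrA ler_wpM2l ?HK.
Qed.

Lemma Re_norm_ge0 (a : R[i]) : 0 <= complex.Re `|a|.
Proof. by rewrite normc_def sqrtr_ge0. Qed.

Lemma rnormD x y : rnorm (x + y) <= rnorm x + rnorm y.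
Proof. by rewrite -lecR -rnormE rmorphD /= -!rnormE ler_normD. Qed.

Lemma rinner_sumr (F : nat -> H) x n :
  rinner x (\sum_(0 <= i < n) F i) = \sum_(0 <= i < n) rinner x (F i).
Proof.
elim: n => [|n IH]; last by rewrite !big_nat_recr //= rinnerDr IH.
by rewrite !big_geq // -(scale0r (0 : H)) (rinnerZr 0) mul0r.
Qed.

Lemma sot_sum_rinner (alpha : nat -> R) T S x : sot_sum alpha T S ->
  series (fun n => alpha n * rnorm (iter n T x) ^+ 2) @ \oo --> rinner x (S x).
Proof.
move=> TS; rewrite (_ : series _ = fun n => rinner x (series (fun n =>
    (alpha n)%:C *: iter n (adjoint T) (iter n T x)) n)).
  exact: cvg_rinner.
apply/funext => n; rewrite /series /= rinner_sumr; apply: eq_bigr => i _.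
by rewrite rinnerZr rinnerC /rinner inner_iter_adjoint.
Qed.

Lemma Im_conjC (a : R[i]) : complex.Im (conjC a) = - complex.Im a.
Proof. by case: a. Qed.

(** The partial sums have real quadratic forms, and pairing with i x carries this to the limit.
    Reality is part of [positive_op]. *)
Lemma sot_sum_Im (alpha : nat -> R) T S x : sot_sum alpha T S ->
  complex.Im (inner (S x) x) = 0.
Proof.
move=> TS; have := cvg_rinner (x := 'i *: x) (TS x).
rewrite (_ : (fun n => _) = (fun=> 0)).
  move=> h; have : rinner ('i *: x) (S x) = 0.
    by apply: (cvg_unique _ h); [exact: Rhausdorff|exact: cvg_cst].
  by rewrite rinner_i [inner x _]innerC Im_conjC opprK.
apply/funext => n; rewrite /series /= rinner_sumr big1_seq // => i _.
by rewrite rinnerZr rinner_i innerC Im_conjC inner_iter_adjoint /= !oppr0 mulr0.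
Qed.

(** The form of T^{*n} T^n at x is |T^n x|^2, which reduces positivity to scalar series. *)
Lemma sot_sum_positive (alpha : nat -> R) T S : sot_sum alpha T S ->
  positive_op S <->
  forall x, cvg_ge0 (fun n => alpha n * rnorm (iter n T x) ^+ 2).
Proof.
move=> TS; split=> [pS x|pS x].
  exists (rinner x (S x)); last exact: sot_sum_rinner.
  by have := pS x; rewrite lecE rinnerC => /andP[].
rewrite lecE (sot_sum_Im x TS) eqxx /=.
have [v v0 hv] := pS x; rewrite -[complex.Re _]/(rinner (S x) x) rinnerC.
by have -> : rinner x (S x) = v
  by apply: (cvg_unique _ (sot_sum_rinner (x := x) TS) hv); exact: Rhausdorff.
Qed.

(** Changing finitely many coefficients adds a finite sum of bounded operators. Applied to the
    eventual sign, it turns admissibility into convergence of the b-series. *)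
Lemma sot_sum_eventually (alpha beta : nat -> R) (k : R) (A : nat) T S :
  sot_sum alpha T S -> (forall n, (A <= n)%N -> beta n = k * alpha n) ->
  exists S', sot_sum beta T S'.
Proof.
move=> TS bA.
pose w i x := iter i (adjoint T) (iter i T x).
pose d i := (beta i - k * alpha i)%:C.
pose f x := k%:C *: S x + \sum_(0 <= i < A) d i *: w i x.
have [M HM] : exists M, forall x, rnorm (f x) <= M * rnorm x.
  rewrite /f; elim: (A) => [|n [M HM]].
    have [M M0 HM] := bounded_op_rnorm S.
    exists (complex.Re `|k%:C| * M) => x; rewrite big_geq // addr0 rnormZ -mulrA.
    by rewrite ler_wpM2l ?Re_norm_ge0.
  have [K1 K10 HK1] := iter_bounded T n.
  have [K2 K20 HK2] := iter_bounded (adjoint T) n.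
  exists (M + complex.Re `|d n| * (K2 * K1)) => x.
  rewrite big_nat_recr //= addrA mulrDl.
  apply: le_trans (rnormD _ _) _; rewrite lerD ?HM // rnormZ -!mulrA ler_wpM2l ?Re_norm_ge0 //.
  by apply: le_trans (HK2 _) _; rewrite ler_wpM2l.
have flin : linear f.
  move=> c u v.
  have e1 : k%:C *: S (c *: u + v) = c *: (k%:C *: S u) + k%:C *: S v.
    by rewrite linearP scalerDr !scalerA mulrC.
  have e2 : \sum_(0 <= i < A) d i *: w i (c *: u + v) =
      c *: (\sum_(0 <= i < A) d i *: w i u) + \sum_(0 <= i < A) d i *: w i v.
    rewrite scaler_sumr -big_split; apply: eq_bigr => i _ /=.
    rewrite /w (iter_linear T i c u v) (iter_linear (adjoint T) i).
    by rewrite scalerDr !scalerA mulrC.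
  by rewrite /f e1 e2 scalerDr addrACA.
have [S' HS'] := bounded_op_exists flin HM.
exists S' => x; rewrite HS' /f -(cvg_shiftn A).
rewrite (_ : (fun n => _) = fun n => k%:C *: series (fun n =>
    (alpha n)%:C *: w n x) (n + A)%N + \sum_(0 <= i < A) d i *: w i x).
  apply: cvgD; last exact: cvg_cst.
  by apply: cvgZl_tmp; rewrite (cvg_shiftn A); exact: TS.
apply/funext => n; rewrite /series /= scaler_sumr.
apply/eqP; rewrite -subr_eq0 opprD addrA -sumrB.
rewrite (big_cat_nat (leq0n A) (leq_addl n A)) /=.
have tail0 : \sum_(A <= i < n + A) ((beta i)%:C *: w i x -
    k%:C *: ((alpha i)%:C *: w i x)) = 0.
  apply: big1_seq => i /andP[_]; rewrite mem_index_iota => /andP[Ai _].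
  by rewrite bA // scalerA -rmorphM subrr.
rewrite [X in _ + X - _]tail0 addr0 -sumrB big1 // => i _.
by rewrite scalerA -rmorphM -scalerBl -rmorphB subrr.
Qed.

End Operators.

Unset Implicit Arguments.

Theorem theorem1p5 (R : realType) (H : hilbertType R) (T : bounded_op H)
    (a b : R) :
  separable H ->
  0 < b -> b < a -> b \isn't a Num.int ->
  c_contraction a T ->
  Admw (coef_1mtX b) T ->
  c_contraction b T.
Proof.
move=> _ b0 ba /nonint_notint bZ [Sa [TSa Sa0]] [_ [Sabs TSabs]].
have [s [A sA]] := coef_1mtX_eventual_sign b.
have [Sb TSb] := sot_sum_eventually TSabs sA.
exists Sb; split=> //; apply/(sot_sum_positive TSb) => x.
(* Shifting u by k replaces x by T^k x, so the operator hypotheses cover every shift. *)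
apply: (difference_descent (u := fun n => rnorm (iter n T x) ^+ 2) b0 ba bZ).
- by move=> n; rewrite sqr_ge0.
- move=> k; apply: cvgP; under eq_fun do rewrite iterD.
  exact: (sot_sum_rinner (x := iter k T x) TSabs).
- move=> k; under eq_fun do rewrite iterD.
  exact: (proj1 (sot_sum_positive TSa) Sa0).
Qed.
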